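(* Let $\alpha\in\{+,-\}$. For a bidirected graph $G$ with vertex $r$, the following two statements are equivalent: (i) $G$ is a triplex $\alpha$-radial with root $r$. (ii) There exist an almost strong $\alpha$-radial $H_1$ with root $r$, a sublinear $\alpha$-radial $H_2$ with root $r$, and a linear $\alpha$-semiradial $H_3$ with root $s$ such that $V(H_2)\cap V(H_1)=\{r\}$, $V(H_3)\cap V(H_i)=\emptyset$ for every $i\in\{1,2\}$, and if $V(H_1)=\{r\}$ then $V(H_3)=\{s\}$, for which $G$ is a gluing sum $(H_3;s)\oplus(H_1+H_2;\,V(H_1)\setminus\{r\})$ or a bidirected graph obtained from this sum by adding some edges between (a) $V(H_2)\setminus\{r\}$ and the union $(V(H_1)\setminus\{r\})\cup(V(H_3)\setminus\{s\})$, in which the end in $V(H_2)$ has the sign $\alpha$, or (b) $r$ and $V(H_3)\setminus\{s\}$, in which $r$ has the sign $\alpha$.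
   Context: A bidirected graph is a finite graph (loops and parallel edges allowed) in which each of the two ends of each edge carries a sign $+$ or $-$; we speak of the sign of $v$ over $e$ (a loop has two ends, each with its own sign). $-\alpha$ denotes the sign opposite to $\alpha$. A ditrail from $x$ to $y$ is a sequence $(v_0,e_1,v_1,\dots,e_k,v_k)$, $k\ge 0$, $v_0=x$, $v_k=y$, where the $e_i$ are pairwise distinct edges (vertices may repeat), $e_i$ joins $v_{i-1}$ and $v_i$, and for $1\le i<k$ the sign of the end of $e_i$ by which it arrives at $v_i$ is opposite to the sign of the end of $e_{i+1}$ by which it leaves $v_i$. If $k\ge1$ it is an $(\alpha,\beta)$-ditrail when the sign of $v_0$ over $e_1$ is $\alpha$ and the sign of $v_k$ over $e_k$ is $\beta$; the trivial ditrail ($k=0$) is regarded as both a $(+,-)$- and a $(-,+)$-ditrail. An $\alpha$-ditrail is an $(\alpha,+)$- or $(\alpha,-)$-ditrail. A closed ditrail over $r$ is a ditrail from $r$ to $r$. A bidirected graph $G$ with $r\in V(G)$ is an $\alpha$-radial (resp. $\alpha$-semiradial) with root $r$ if for every $v\in V(G)$ there is an $(\alpha,-\alpha)$-ditrail (resp. an $\alpha$-ditrail) from $v$ to $r$. In an $\alpha$-radial with root $r$ a vertex $x$ is strong if there is a $(-\alpha,-\alpha)$-ditrail from $x$ to $r$, and sublinear otherwise; ''sublinear root'' means that $r$ itself is sublinear. An $\alpha$-radial with root $r$ is sublinear if it has no $(-\alpha,-\alpha)$-ditrail from $x$ to $r$ for any vertex $x$ (including $r$). It is almost strong if every vertex other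 than $r$ is strong but there is no closed $(-\alpha,-\alpha)$-ditrail over $r$. An $\alpha$-semiradial $G$ with root $r$ is linear if it has no loop over $r$ and there is no $-\alpha$-ditrail from $x$ to $r$ for any $x\in V(G)$, except for the trivial ditrail from $r$ to $r$ with no edge. Grounds. For an $\alpha$-radial $G$ with sublinear root $r$, the almost strong ground $H$ of $G$ is the maximum subgraph of $G$ that is an almost strong $\alpha$-radial with root $r$ (the single vertex $r$ counts as one). The extended ground of $G$ is the maximum subgraph $I$ of $G$ such that $I$ is an $\alpha$-radial with root $r$, $I$ contains $H$, and every vertex in $V(I)\setminus V(H)$ is sublinear in $G$. (Both maxima exist.) An $\alpha$-radial $G$ with sublinear root $r$ is a triplex if it is equal to its extended ground. $H_1+H_2$ denotes the union of the graphs $H_1$ and $H_2$. Gluing sum. Let $G,H$ be disjoint bidirected graphs, $s\in V(G)$, $T\subseteq V(H)$. A gluing sum $(G;s)\oplus(H;T)$ is any bidirected graph $\hat G$ with $V(\hat G)=(V(G)\setminus\{s\})\cup V(H)$ whose edges are: all edges of $G$ not incident with $s$, all edges of $H$, and, for each edge $e$ of $G$ incident with $s$, exactly one edge $f(e)$ such that: if $e$ joins $s$ and $v\neq s$, then $f(e)$ joins some $t\in T$ and $v$, with the signs of $t$ and $v$ over $f(e)$ equal to the signs of $s$ and $v$ over $e$; if $e$ is a loop over $s$ with signs $\alpha_1,\alpha_2$, then $f(e)$ joins two (possibly identical) vertices of $T$ with signs $\alpha_1,\alpha_2$. (Gluing sums are not unique.)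
   Formalization: In (a) the printed intersection of V(H1)\{r} and V(H3)\{s}, which is always empty and makes (i)⇒(ii) false, is read as their union, as the word ''union'' says. *)

(* Defs.v *)
From mathcomp Require Import all_boot.
From mathcomp Require Import finmap.

Set Implicit Arguments.
Unset Strict Implicit.
Unset Printing Implicit Defensive.

Local Open Scope fset_scope.

(* A sign is a boolean: [true] is +, [false] is -, and [~~ a] is -a. *)
Notation sign := bool (only parsing).

(* Vertices and edges are names taken from V and E, and every graph carries
   its own assignment of ends. The two ends of an edge are stored as an
   ordered pair, but the order is meaningless (see [joins] and [same_ends]);
   the value of [ends] outside [edges] is irrelevant. *)
Record bigraph (V E : choiceType) := Bigraph {
  verts : {fset V};
  edges : {fset E};
  ends : E -> (V * sign) * (V * sign);
  ends_verts : forall e, e \in edges ->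
    ((ends e).1.1 \in verts) && ((ends e).2.1 \in verts)
}.

Section Bidirected.

Variables V E : choiceType.
Implicit Types (G H I K : bigraph V E) (a b : sign) (r s x y : V) (e : E).

Definition joins G e (p q : V * sign) : bool :=
  (ends G e == (p, q)) || (ends G e == (q, p)).

Definition same_ends G H e : bool :=
  joins G e (ends H e).1 (ends H e).2.

Definition incident G x e : bool :=
  ((ends G e).1.1 == x) || ((ends G e).2.1 == x).

Definition loop_over G x e : bool :=
  ((ends G e).1.1 == x) && ((ends G e).2.1 == x).

(* One step of a ditrail: the vertex left and the sign by which it is left,
   the edge, the vertex reached and the sign by which it is reached. *)
Definition dart : Type := (V * sign) * E * (V * sign).
Definition dtail (d : dart) : V * sign := d.1.1.
Definition dedge (d : dart) : E := d.1.2.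
Definition dhead (d : dart) : V * sign := d.2.

Definition is_dart G (d : dart) : bool :=
  (dedge d \in edges G) && joins G (dedge d) (dtail d) (dhead d).

Definition dlink (d d' : dart) : bool :=
  ((dtail d').1 == (dhead d).1) && ((dtail d').2 == ~~ (dhead d).2).

Definition ditrail G x (p : seq dart) y : bool :=
  if p is d :: q then
    [&& (dtail d).1 == x, (dhead (last d q)).1 == y,
        all (is_dart G) p, sorted dlink p & uniq (map dedge p)]
  else (x \in verts G) && (x == y).

(* The trivial ditrail is both a (+,-)- and a (-,+)-ditrail. *)
Definition has_signs a b (p : seq dart) : bool :=
  if p is d :: q then ((dtail d).2 == a) && ((dhead (last d q)).2 == b)
  else b == ~~ a.

Definition ab_ditrail G a b x y : Prop :=
  exists p, ditrail G x p y /\ has_signs a b p.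

Definition a_ditrail G a x y : Prop := exists b, ab_ditrail G a b x y.

Definition radial a G r : Prop :=
  r \in verts G /\ forall v, v \in verts G -> ab_ditrail G a (~~ a) v r.

Definition semiradial a G r : Prop :=
  r \in verts G /\ forall v, v \in verts G -> a_ditrail G a v r.

Definition strong a G r x : Prop := ab_ditrail G (~~ a) (~~ a) x r.

Definition sublinear a G r x : Prop := ~ strong a G r x.

Definition sublinear_radial a G r : Prop :=
  radial a G r /\ forall x, x \in verts G -> sublinear a G r x.

Definition almost_strong a G r : Prop :=
  [/\ radial a G r,
      forall x, x \in verts G -> x <> r -> strong a G r x
    & ~ strong a G r r].

(* The only trivial ditrail ending at r is the one from r to r. *)
Definition linear_semiradial a G r : Prop :=
  [/\ semiradial a G r,
      forall e, e \in edges G -> ~~ loop_over G r e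
    & forall x p b, ditrail G x p r -> has_signs (~~ a) b p -> p = [::]].

Definition subgraph H G : Prop :=
  [/\ verts H `<=` verts G, edges H `<=` edges G
    & forall e, e \in edges H -> same_ends G H e].

(* Maximum with respect to [subgraph], hence unique up to the irrelevant data
   in [ends]. *)
Definition maximum_subgraph G (P : bigraph V E -> Prop) H : Prop :=
  [/\ subgraph H G, P H & forall K, subgraph K G -> P K -> subgraph K H].

Definition almost_strong_ground a G r H : Prop :=
  maximum_subgraph G (fun K => almost_strong a K r) H.

Definition extended_ground a G r I : Prop :=
  exists H, almost_strong_ground a G r H /\
    maximum_subgraph G
      (fun K => [/\ radial a K r, subgraph H K
                  & forall x, x \in verts K `\` verts H -> sublinear a G r x])
      I.

Definition triplex a G r : Prop :=
  [/\ radial a G r, sublinear a G r r & extended_ground a G r G].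

(* G and H agree on the edges they share; this is what makes their union a
   graph having both as subgraphs. *)
Definition compatible G H : Prop :=
  forall e, e \in edges G -> e \in edges H -> same_ends G H e.

Definition union_ends G H e : (V * sign) * (V * sign) :=
  if e \in edges G then ends G e else ends H e.

Lemma union_ends_verts G H e : e \in edges G `|` edges H ->
  ((union_ends G H e).1.1 \in verts G `|` verts H) &&
  ((union_ends G H e).2.1 \in verts G `|` verts H).
Proof.
rewrite /union_ends !in_fsetU; case: (boolP (e \in edges G)) => /= he.
  by move=> _; case/andP: (ends_verts he) => -> ->.
by move=> /ends_verts /andP[-> ->]; rewrite !orbT.
Qed.

Definition gunion G H : bigraph V E :=
  Bigraph (@union_ends_verts G H).

Definition disjoint_graphs G H : Prop :=
  [disjoint verts G & verts H] /\ [disjoint edges G & edges H].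

(* K is a gluing sum (G; s) (+) (H; T). The names f e are pairwise distinct and
   distinct from those of the other edges of K; f e = e is allowed. *)
Definition gluing_sum G s H (T : {fset V}) K : Prop :=
  let kept := [fset e in edges G | ~~ incident G s e] in
  let glued := [fset e in edges G | incident G s e] in
  [/\ disjoint_graphs G H, s \in verts G, T `<=` verts H,
      verts K = (verts G `\ s) `|` verts H
    & exists f : E -> E,
      [/\ {in glued &, injective f},
          forall e, e \in glued -> f e \notin kept `|` edges H,
          edges K = (kept `|` edges H) `|` [fset f e | e in glued],
          (forall e, e \in kept -> same_ends K G e) /\
          (forall e, e \in edges H -> same_ends K H e)
        & forall e, e \in glued ->
          (forall v a b, v <> s -> joins G e (s, a) (v, b) ->
             exists2 t, t \in T & joins K (f e) (t, a) (v, b)) /\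
          (forall a b, joins G e (s, a) (s, b) ->
             exists t1 t2, [/\ t1 \in T, t2 \in T
                             & joins K (f e) (t1, a) (t2, b)])]].

(* G is obtained from K by adding some (possibly no) edges, each of which
   satisfies P in G. *)
Definition add_edges K (P : E -> Prop) G : Prop :=
  [/\ subgraph K G, verts G = verts K
    & forall e, e \in edges G `\` edges K -> P e].

(* In G, e joins X and Y and its end in X has the sign a. *)
Definition joins_sets G (X : {fset V}) a (Y : {fset V}) e : Prop :=
  exists x y b, [/\ x \in X, y \in Y & joins G e (x, a) (y, b)].

End Bidirected.

(* Main.v *)
Require Import Defs.
From mathcomp Require Import all_boot.
From mathcomp Require Import finmap.
From mathcomp Require Import boolp.

(* Let W be the vertex set of the almost strong ground. As a vertex outside
   [W `\ r] is not strong, no edge between two such vertices has both signs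
   [~~ a], and an edge from [W `\ r] to the outside has the sign [a] at its outer
   end. So ditrails to r from outside run along edges with signs [a],
   [~~ a] until they first meet W: the vertices outside W that can do so at r span
   [H2], and the others, which meet W elsewhere, give [H3] once [W `\ r] is
   contracted to s.

   Conversely, a ditrail leaving a vertex outside [W `\ r] by the sign [~~ a]
   goes on leaving such vertices by [~~ a], except inside [H1]. To arrive at r by
   [~~ a] it would have to leave r by [~~ a] and come back so within [H1], which
   almost strong radials exclude. *)

Set Implicit Arguments.
Unset Strict Implicit.
Unset Printing Implicit Defensive.

Local Open Scope fset_scope.

(** * Ditrails *)

Section Trails.

Variables V E : choiceType.
Implicit Types (G H K : bigraph V E) (a b : bool) (r s x y : V) (e : E).
Implicit Types (u w z : V * bool) (d : dart V E) (p q : seq (dart V E)).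

(** Turns an arrival into the next departure and back: a vertex reached by a sign is left by the
    opposite one. *)
Definition flip u : V * bool := (u.1, ~~ u.2).

Lemma flipK : involutive flip.
Proof. by case=> x b; rewrite /flip /= negbK. Qed.

Lemma joinsC G e u w : joins G e u w = joins G e w u.
Proof. by rewrite /joins orbC. Qed.

Lemma joins_ends G e : joins G e (ends G e).1 (ends G e).2.
Proof. by rewrite /joins -surjective_pairing eqxx. Qed.

Lemma joinsP G e u w : joins G e u w ->
  ends G e = (u, w) \/ ends G e = (w, u).
Proof. by case/orP=> /eqP; [left|right]. Qed.

Lemma joins_inj G e u w u' w' : joins G e u w -> joins G e u' w' ->
  (u' = u /\ w' = w) \/ (u' = w /\ w' = u).
Proof. by move=> /joinsP h /joinsP; case: h => -> [] [-> ->]; auto. Qed.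

Lemma same_endsP G H e u w : same_ends G H e -> joins G e u w = joins H e u w.
Proof.
rewrite /same_ends /joins; case: (ends H e) => u1 u2 /=.
case/orP=> /eqP ->; rewrite !xpair_eqE //.
by rewrite orbC ![(u2 == _) && _]andbC.
Qed.

Lemma joins_verts G e u w : e \in edges G -> joins G e u w ->
  u.1 \in verts G /\ w.1 \in verts G.
Proof.
by move=> /ends_verts /andP[h1 h2] /joinsP[] eq_e; move: h1 h2; rewrite eq_e.
Qed.

Lemma subgraph_dart H G d : subgraph H G -> is_dart H d -> is_dart G d.
Proof.
case=> _ /fsubsetP sE sends /andP[he hj]; apply/andP; split; first exact: sE.
by rewrite (same_endsP _ _ (sends _ he)).
Qed.

(* The trivial ditrail being both a (+,-)- and a (-,+)-ditrail is what makes
   this recursion uniform: [u] is a vertex with the sign by which it is left,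
   [w] one with the sign by which it is reached. *)
Fixpoint trail G u p w : bool :=
  if p is d :: q then
    [&& dtail d == u, is_dart G d, dedge d \notin map (@dedge V E) q
      & trail G (flip (dhead d)) q w]
  else (u.1 \in verts G) && (w == flip u).

Lemma trailE G u p w :
  ditrail G u.1 p w.1 && has_signs u.2 w.2 p = trail G u p w.
Proof.
elim: p u => [|d p IHp] u.
  by rewrite /= -andbA; case: u w => x a [y b]; rewrite /flip xpair_eqE [y == x]eq_sym.
rewrite [RHS]/= -{}IHp; case: d => [[[x a] e] [y b]]; rewrite /ditrail /has_signs /=.
case: u w => x' a' [y' b']; rewrite xpair_eqE /dtail /dedge /dhead /flip /=.
case: p => [|d p] /=.
  (* [trail] checks the end vertex in its base case, while a nontrivial [ditrail] says nothing of
     [verts]; [joins_verts] supplies the membership. *)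
  rewrite /is_dart /dedge /dtail /dhead /= negbK.
  case he: (e \in edges G) => /=; last by rewrite !andbF.
  case hj: (joins G e _ _) => /=; last by rewrite !andbF.
  have [_ /= ->] := joins_verts he hj.
  by rewrite [b' == b]eq_sym /= !andbT; do !case: (_ == _).
rewrite /dlink /dtail /dhead /dedge /=.
set A := _ == x'; set B := _ == a'; set C := is_dart G _; set D := is_dart G _.
set F := _ == y; set J := _ == ~~ b; set L := path _ _ _.
set M := _ \notin _; set N := _ == y'; set O := _ == b'.
by case: A B C D F J L M N O => [] [] [] [] [] [] [] [] [] []; rewrite ?andbF ?andbT.
Qed.

Lemma ab_ditrailP G a b x y :
  ab_ditrail G a b x y <-> exists p, trail G (x, a) p (y, b).
Proof.
split=> -[p]; first by case=> h1 h2; exists p; rewrite -trailE /= h1 h2.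
by rewrite -trailE => /andP[]; exists p.
Qed.

Lemma trail_verts G u p w : trail G u p w -> u.1 \in verts G.
Proof.
case: p => [|d p] /=; first by case/andP.
by case/and4P=> /eqP<- /andP[he /(joins_verts he)[]].
Qed.

Lemma trail_dart G u p w d : trail G u p w -> d \in p -> is_dart G d.
Proof.
elim: p u => //= d' p IHp u /and4P[_ hd _ ht]; rewrite inE => /predU1P[->//|].
exact: IHp ht.
Qed.

Lemma trail_edges G u p w e :
  trail G u p w -> e \in map (@dedge V E) p -> e \in edges G.
Proof. by move=> ht /mapP[d hd ->]; case/andP: (trail_dart ht hd). Qed.

Lemma trail_suffix G u p w d : trail G u p w -> d \in p ->
  exists2 q, trail G (dtail d) (d :: q) w & {subset d :: q <= p}.
Proof.
elim: p u => //= d' p IHp u /and4P[hu hd' hn ht]; rewrite inE => /predU1P[->|hd].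
  by exists p; rewrite ?eqxx ?hd' ?hn.
have [q hq sq] := IHp _ ht hd.
by exists q => // x /sq; rewrite inE orbC => ->.
Qed.

Lemma trail_cat G u p w q z : trail G u p w -> trail G (flip w) q z ->
  (forall e, e \in map (@dedge V E) p -> e \notin map (@dedge V E) q) ->
  trail G u (p ++ q) z.
Proof.
elim: p u => [|d p IHp] u /=.
  by case/andP=> _ /eqP->; rewrite flipK.
case/and4P=> -> -> hd ht hq dis /=; rewrite map_cat mem_cat negb_or hd /=.
rewrite dis ?inE ?eqxx //=; apply: IHp => // e he.
by apply: dis; rewrite inE he orbT.
Qed.

Lemma trail_sub G H u p w : u.1 \in verts H ->
  (forall d, d \in p -> is_dart G d -> is_dart H d) ->
  trail G u p w -> trail H u p w.
Proof.
elim: p u => [|d p IHp] u /= hu hd; first by case/andP=> _ ->; rewrite hu.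
case/and4P=> -> hdG -> ht; have hdH := hd d (mem_head _ _) hdG.
rewrite hdH /=; apply: IHp ht.
  by case/andP: hdH => he /(joins_verts he)[].
by move=> d' hd'; apply: hd; rewrite inE hd' orbT.
Qed.

Lemma subgraph_trail H G u p w : subgraph H G -> trail H u p w -> trail G u p w.
Proof.
move=> sHG ht; apply: (trail_sub _ _ ht) => [|d _]; last exact: subgraph_dart.
by case: sHG => /fsubsetP sV _ _; apply/sV/(trail_verts ht).
Qed.

Lemma subgraph_ab_ditrail H G a b x y : subgraph H G ->
  ab_ditrail H a b x y -> ab_ditrail G a b x y.
Proof.
by move=> s /ab_ditrailP[p hp]; apply/ab_ditrailP; exists p; apply: subgraph_trail hp.
Qed.

Lemma subgraph_refl G : subgraph G G.
Proof. by split=> // e _; apply: joins_ends. Qed.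

(* Either [e] can be prepended to the trail from [y], or that trail uses [e]
   and its suffix from there leaves an end of [e] by the sign [~~ a]. *)
Lemma negative_edge_trail G a e x y p z : e \in edges G ->
  joins G e (x, ~~ a) (y, ~~ a) -> trail G (y, a) p z ->
  exists u q, [/\ trail G u q z, q <> [::], u.2 = ~~ a & u.1 \in [:: x; y]].
Proof.
move=> he hj ht; have [/mapP[d hd def_e]|hep] := boolP (e \in map (@dedge V E) p).
  have [q hq _] := trail_suffix ht hd.
  have /andP[_] := trail_dart ht hd; rewrite -def_e => hj'.
  exists (dtail d), (d :: q); split=> //.
    by case: (joins_inj hj hj') => -[-> _].
  by case: (joins_inj hj hj') => -[-> _]; rewrite !inE eqxx ?orbT.
exists (x, ~~ a), (((x, ~~ a), e, (y, ~~ a)) :: p); split; rewrite ?mem_head //=.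
by rewrite eqxx /is_dart he hj hep /flip /= negbK.
Qed.

(* If leaving a vertex by [~~ a] always means arriving by [a], then the sign
   [~~ a] of departure persists along a ditrail. *)
Lemma no_negative_trail G a (Q : pred (V * bool)) u p w :
  (forall d, is_dart G d -> (dtail d).2 = ~~ a ->
     (dhead d).2 = a /\ ~~ Q (dhead d)) ->
  trail G u p w -> u.2 = ~~ a -> Q w -> p = [::].
Proof.
move=> hG; elim: p u => //= d p IHp u /and4P[/eqP <- hd _ ht] hu hw.
have [hh hQ] := hG d hd hu.
have p0 : p = [::] by apply: IHp ht _ hw; rewrite /flip /= hh.
by move: ht; rewrite p0 /= flipK => /andP[_ /eqP hwd]; rewrite hwd (negPf hQ) in hw.
Qed.

(** * Radials and linear semiradials *)

Lemma radialP a G r : radial a G r <->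
  r \in verts G /\ forall v, v \in verts G -> exists p, trail G (v, a) p (r, ~~ a).
Proof.
by split=> -[hr h]; split=> // v /h; [move/ab_ditrailP | move=> hp; apply/ab_ditrailP].
Qed.

Lemma strongP a G r x : strong a G r x <-> exists p, trail G (x, ~~ a) p (r, ~~ a).
Proof. exact: ab_ditrailP. Qed.

(** Otherwise [negative_edge_trail], applied to an (a, -a)-ditrail from [y] to [r], would make an
    end of [e] strong. *)
Lemma sublinear_radial_edges a G r e x y : sublinear_radial a G r ->
  e \in edges G -> ~ joins G e (x, ~~ a) (y, ~~ a).
Proof.
case=> /radialP[hr hrad] hsub he hj; have [/= _ hy] := joins_verts he hj.
have [p hp] := hrad y hy.
have [u [q [hq _ hu _]]] := negative_edge_trail he hj hp.
apply: (hsub u.1); first exact: trail_verts hq.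
by apply/strongP; exists q; case: u hq hu => x' b /= + eb; rewrite eb.
Qed.

Lemma linear_semiradial_trail a G r u p b : linear_semiradial a G r ->
  trail G u p (r, b) -> u.2 = ~~ a -> p = [::].
Proof.
by case=> _ _ hl; rewrite -trailE => /andP[/= ht hs] hu; apply: (hl _ _ b ht); rewrite -hu.
Qed.

Lemma linear_semiradial_edges a G r e x y : linear_semiradial a G r ->
  e \in edges G -> ~ joins G e (x, ~~ a) (y, ~~ a).
Proof.
move=> hlin he hj; have [/= _ hy] := joins_verts he hj.
have [[hr hrad] _ _] := hlin; have [b /ab_ditrailP[p hp]] := hrad y hy.
have [u [q [hq q0 hu _]]] := negative_edge_trail he hj hp.
exact/q0/(linear_semiradial_trail hlin hq).
Qed.

(** An edge at the root with the sign [~~ a] at its other end would by itself be a forbidden ditrail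
    to the root. *)
Lemma linear_semiradial_root_edges a G r e x b c : linear_semiradial a G r ->
  e \in edges G -> joins G e (r, b) (x, c) -> x != r /\ c = a.
Proof.
move=> hlin he hj; have [_ hloop _] := hlin; split.
  apply: contraNneq (hloop e he) => hx; rewrite hx in hj.
  by rewrite /loop_over; case: (joinsP hj) => ->; rewrite /= eqxx.
have [//|hc] := eqVneq c a; suff: [:: ((x, c), e, (r, b))] = [::] by [].
have [hrG hxG] := joins_verts he hj.
apply: (@linear_semiradial_trail a G r (x, c) _ b) => //=; last first.
  by move: hc; case: (c) (a) => [] [].
by rewrite eqxx /is_dart he joinsC hj flipK /=; move: hrG => /= ->; rewrite eqxx.
Qed.

Lemma trail_end_vert G u p w : trail G u p w -> w.1 \in verts G.
Proof.
elim: p u => [|d p IHp] u /=; first by case/andP=> hu /eqP->.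
by case/and4P=> _ _ _ /IHp.
Qed.

(* Departures by [~~ a] from outside [verts H `\ r] persist until the ditrail
   enters [H] through [r]; from then on the part inside [H] is the ditrail [q],
   which must not close up at [r] with the sign [~~ a]. *)
Lemma almost_strong_no_trail a G H r : almost_strong a H r ->
  (forall d, is_dart G d -> ~~ is_dart H d ->
     (dtail d).1 \in verts H `\ r \/ (dtail d).2 = ~~ a ->
     (dhead d).1 \notin verts H `\ r /\ (dhead d).2 = a) ->
  forall p u,
    (u.2 = ~~ a /\ u.1 \notin verts H) \/
    (exists2 q, trail H (r, ~~ a) q (flip u)
       & forall e, e \in map (@dedge V E) q -> e \notin map (@dedge V E) p) ->
  ~ trail G u p (r, ~~ a).
Proof.
case=> -[hr _] _ hcl hG.
have hclosed q : ~ trail H (r, ~~ a) q (r, ~~ a).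
  by move=> hq; apply: hcl; apply/strongP; exists q.
elim=> [|d p IHp] u hu /=.
  case/andP=> _ /eqP [er ea]; case: hu => [[hu _]|[q hq _]].
    by move: ea; rewrite hu; case: (a).
  by apply: (hclosed q); move: hq; rewrite /flip -er -ea.
(* A step inside [H] prolongs [q]; any other step is controlled by the hypothesis on darts. *)
case/and4P=> /eqP hd hdG hn ht; have [hdH|hdH] := boolP (is_dart H d).
  case: hu => [[_ /negP[]]|[q hq hdis]].
    by rewrite -hd; case/andP: hdH => he /(joins_verts he)[].
  apply: IHp ht; right; exists (q ++ [:: d]).
    rewrite !flipK; apply: trail_cat hq _ _ => [|e /hdis]; last first.
      by rewrite !inE negb_or => /andP[].
    rewrite flipK /= hd eqxx hdH flipK eqxx andbT /=.
    by case/andP: hdH => he /(joins_verts he)[].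
  move=> e; rewrite map_cat mem_cat inE => /orP[/hdis|/eqP->//].
  by rewrite inE negb_or => /andP[].
have [|hh1 hh2] := hG d hdG hdH.
  rewrite hd; case: hu => [[hu _]|[q hq _]]; first by right.
  have := trail_end_vert hq; rewrite !inE /= => hu.
  (* At [r] the departure is by [~~ a], since otherwise [q] would close up there. *)
  have [hur|] := eqVneq u.1 r; last by rewrite hu; left.
  right; have [//|hua] := eqVneq u.2 (~~ a).
  have {hua} hua: ~~ u.2 = ~~ a by move: hua; case: (u.2) (a) => [] [].
  by case: (hclosed q); move: hq; rewrite /flip hur hua.
apply: IHp ht; rewrite /= hh2; move: hh1; rewrite !inE negb_and negbK.
case/orP=> [/eqP hhr|]; last by left.
right; exists [::] => //.
by rewrite /= hr flipK [dhead d]surjective_pairing hhr hh2 /flip /= negbK.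
Qed.

(** * Induced subgraphs and a criterion for triplexes *)

Lemma induced_ends_verts G (W : {fset V}) e :
  e \in [fset e in edges G | ((ends G e).1.1 \in W) && ((ends G e).2.1 \in W)] ->
  ((ends G e).1.1 \in verts G `&` W) && ((ends G e).2.1 \in verts G `&` W).
Proof.
by rewrite !inE /= => /and3P[/ends_verts /andP[-> ->] -> ->].
Qed.

Definition induced G W : bigraph V E := Bigraph (@induced_ends_verts G W).

Lemma induced_subgraph G W : subgraph (induced G W) G.
Proof.
split; first exact: fsubsetIl.
  by apply/fsubsetP=> e; rewrite !inE => /andP[].
by move=> e _; apply: joins_ends.
Qed.

Lemma subgraph_induced G K W : subgraph K G -> verts K `<=` W ->
  subgraph K (induced G W).
Proof.
move=> [sV /fsubsetP sE sends] /fsubsetP sW; split.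
- by rewrite fsubsetI sV; apply/fsubsetP.
- apply/fsubsetP=> e he; rewrite !inE sE //=.
  have hj : joins K e (ends G e).1 (ends G e).2.
    by rewrite -(same_endsP _ _ (sends _ he)) joins_ends.
  by have [/sW -> /sW ->] := joins_verts he hj.
- by move=> e /sends.
Qed.

Lemma subgraph_almost_strong a H K r : subgraph H K -> verts K = verts H ->
  almost_strong a H r -> ~ strong a K r r -> almost_strong a K r.
Proof.
move=> sHK eV [[hr hrad] hstr _] hcl; split=> //; first split; rewrite ?eV //.
  by move=> v /hrad; apply: subgraph_ab_ditrail.
by move=> x hx hxr; apply: subgraph_ab_ditrail sHK (hstr x hx hxr).
Qed.

(** Additional edges preserve the required ditrails and could only create a closed one over [r],
    which sublinearity of [r] in [G] excludes. *)
Lemma almost_strong_induced a G H r : subgraph H G -> almost_strong a H r ->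
  sublinear a G r r -> almost_strong a (induced G (verts H)) r.
Proof.
move=> sHG hH hr; have sV : verts H `<=` verts G by case: sHG.
apply: (subgraph_almost_strong _ _ hH); first exact: subgraph_induced.
- by apply/fsetIidPr.
- by move=> /(subgraph_ab_ditrail (induced_subgraph _ _)).
Qed.

(** By [almost_strong_no_trail] the root and all vertices outside [H] are sublinear. So no almost
    strong subgraph has a vertex outside [H], the graph induced on [verts H] is the ground, and [G]
    itself qualifies as the extended ground. *)
Lemma triplex_intro a G H r : radial a G r -> almost_strong a H r ->
  subgraph H G ->
  (forall d, is_dart G d -> ~~ is_dart H d ->
     (dtail d).1 \in verts H `\ r \/ (dtail d).2 = ~~ a ->
     (dhead d).1 \notin verts H `\ r /\ (dhead d).2 = a) ->
  triplex a G r.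
Proof.
move=> hrad hH sHG hG; have hno := almost_strong_no_trail hH hG.
have hr : sublinear a G r r.
  case/strongP=> p; apply: hno; right; exists [::] => //.
  by case: hH => -[/= -> _] _ _; rewrite eqxx.
have hout x : x \notin verts H -> sublinear a G r x.
  by move=> hx /strongP[p]; apply: hno; left.
have sV : verts H `<=` verts G by case: sHG.
have eV : verts (induced G (verts H)) = verts H by apply/fsetIidPr.
split=> //; exists (induced G (verts H)); split; split.
- exact: induced_subgraph.
- exact: almost_strong_induced.
- move=> K sKG [_ hstr _]; apply: subgraph_induced => //.
  apply/fsubsetP=> x hx; have [->|/eqP hxr] := eqVneq x r; first by case: hH => -[].
  apply: contrapT => /negP /hout; apply.
  exact: subgraph_ab_ditrail sKG (hstr x hx hxr).
- exact: subgraph_refl.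
- split=> //; first exact: induced_subgraph.
  by move=> x; rewrite eV inE => /andP[/hout].
- by [].
Qed.

(** The form in which a triplex enters the decomposition: as [G] is its own extended ground,
    sublinearity outside the ground concerns all of [G]. *)
Lemma triplexP a G r : triplex a G r ->
  [/\ radial a G r, sublinear a G r r & exists H, [/\ subgraph H G,
     almost_strong a H r & forall x, x \in verts G `\` verts H -> sublinear a G r x]].
Proof.
by case=> hrad hr [H [[sHG hH _] [_ [_ _ hout] _]]]; split=> //; exists H.
Qed.

(** * Gluing sums are triplexes *)

Lemma subgraph_trans G H K : subgraph H G -> subgraph K H -> subgraph K G.
Proof.
move=> [vG eG sG] [vH eH sH]; split; first exact: fsubset_trans vG.
  exact: fsubset_trans eG.
move=> e he; rewrite /same_ends (same_endsP _ _ (sG _ _)); first exact: sH.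
exact: (fsubsetP eH).
Qed.

Lemma gunion_subgraphl G H : subgraph G (gunion G H).
Proof.
split=> /=; [exact: fsubsetUl | exact: fsubsetUl | move=> e he].
by rewrite /same_ends /joins /= /union_ends he -surjective_pairing eqxx.
Qed.

Lemma gunion_subgraphr G H : compatible G H -> subgraph H (gunion G H).
Proof.
move=> hc; split=> /=; [exact: fsubsetUr | exact: fsubsetUr | move=> e he].
rewrite /same_ends /joins /= /union_ends; case: ifP => heG.
  exact: hc heG he.
by rewrite -surjective_pairing eqxx.
Qed.

Lemma gluing_sum_subgraphr G s H (T : {fset V}) K :
  gluing_sum G s H T K -> subgraph H K.
Proof.
case=> _ _ _ eV [f [_ _ eE [_ hH] _]]; split=> //; first by rewrite eV fsubsetUr.
by apply/fsubsetP=> e he; rewrite eE !inE he orbT.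
Qed.

(** Follow a ditrail of [H3] up to its first edge at [s]. The glued copy of that edge leads to some
    [t] in [T], from which [H1] offers a ditrail to [r] whatever the sign of departure. *)
Lemma gluing_sum_radial a G H1 H2 H3 s (T : {fset V}) K r :
  almost_strong a H1 r -> linear_semiradial a H3 s -> T `<=` verts H1 `\ r ->
  gluing_sum H3 s (gunion H1 H2) T K -> subgraph K G ->
  forall v, v \in verts H3 `\ s -> exists p, trail G (v, a) p (r, ~~ a).
Proof.
move=> hH1 hH3 hT hglue sKG; have sHK := gluing_sum_subgraphr hglue.
have sH1G : subgraph H1 G.
  exact: subgraph_trans sKG (subgraph_trans sHK (gunion_subgraphl _ _)).
case: hglue => [[_ disE] hs _ eV [f [_ hf eE [hk hH] hg]]].
(* The second conclusion, that the kept edges of [H3] in [q] come from [p], is what keeps edges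
   distinct in the induction. *)
have step p : forall u b, trail H3 u p (s, b) -> u.1 != s ->
  exists2 q, trail G u q (r, ~~ a) & forall e, e \in edges H3 ->
    ~~ incident H3 s e -> e \in map (@dedge V E) q -> e \in map (@dedge V E) p.
  elim: p => [|d p IHp] u b /=.
    by case: u => x c /andP[_ /eqP[->]]; rewrite eqxx.
  case/and4P=> /eqP hd /andP[he hj] hn ht hus.
  have [hinc|hinc] := boolP (incident H3 s (dedge d)); last first.
    have hhs : (flip (dhead d)).1 != s.
      apply: contraNneq hinc => /= <-; rewrite /incident.
      by case: (joinsP hj) => ->; rewrite eqxx ?orbT.
    have [q hq sq] := IHp _ _ ht hhs; exists (d :: q) => /=; last first.
      by move=> e heH hi; rewrite !inE => /predU1P[->|/(sq _ heH hi) ->]; rewrite ?eqxx ?orbT.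
    have hdk : dedge d \in [fset e in edges H3 | ~~ incident H3 s e] by rewrite !inE he.
    have hdK : is_dart K d.
      by rewrite /is_dart eE !inE he hinc /= (same_endsP _ _ (hk _ hdk)).
    rewrite hd eqxx (subgraph_dart sKG hdK) hq andbT /=.
    by apply: contra hn => /(sq _ he hinc).
  have hdg : dedge d \in [fset e in edges H3 | incident H3 s e] by rewrite !inE he.
  have hhs : (dhead d).1 = s.
    apply/eqP; move: hinc hus; rewrite -hd /incident.
    by case: (joinsP hj) => -> /= /orP[] // ->.
  have [h1 _] := hg _ hdg; set c := (dhead d).2.
  have hju : joins H3 (dedge d) (s, c) (u.1, u.2).
    by rewrite joinsC -hhs -!surjective_pairing -hd.
  have [t /(fsubsetP hT) ht1 htK] := h1 _ _ _ (elimN eqP hus) hju.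
  (* [t] is left by [a] because [H1] is a radial, and by [~~ a] because [t] is strong in it. *)
  have [q hq] : exists q, trail H1 (t, ~~ c) q (r, ~~ a).
    move: ht1; rewrite !inE => /andP[/eqP htr htW]; case: hH1 => hrad hstr _.
    have [hca|hca] := eqVneq (~~ c) a.
      by rewrite hca; case/radialP: hrad => _; apply.
    have -> : ~~ c = ~~ a by move: hca; case: (c) (a) => [] [].
    exact/strongP/hstr.
  have fe := hf _ hdg; exists ((u, f (dedge d), (t, c)) :: q) => [|e heH hi].
    have hd' : is_dart K (u, f (dedge d), (t, c)).
      rewrite /is_dart joinsC [dtail _]surjective_pairing htK andbT eE inE.
      by apply/orP; right; apply/imfsetP; exists (dedge d).
    rewrite /= eqxx (subgraph_trail sH1G hq) andbT (subgraph_dart sKG hd') /=.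
    apply: contra fe => /(trail_edges hq) he1.
    by rewrite !inE he1 /= orbT.
  rewrite inE => /predU1P[ee|/(trail_edges hq) he1].
    by case/negP: fe; rewrite !inE; move: ee; rewrite /dedge /= => <-; rewrite heH hi.
  by case/negP: (fdisjointP disE _ heH); rewrite !inE he1.
move=> v; rewrite !inE => /andP[hvs hv]; case: hH3 => -[_ hsr] _ _.
have [b /ab_ditrailP[p hp]] := hsr v hv.
by have [q hq _] := step p (v, a) b hp hvs; exists q.
Qed.

(** The dart condition of [triplex_intro] is checked by the origin of the edge: added and glued
    edges through [hpos], those of [H2] and the kept ones of [H3] through [hneg]. *)
Lemma gluing_sum_triplex a (G H1 H2 H3 K : bigraph V E) r s :
  almost_strong a H1 r -> sublinear_radial a H2 r -> linear_semiradial a H3 s ->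
  verts H2 `&` verts H1 = [fset r] -> verts H3 `&` verts H1 = fset0 ->
  compatible H1 H2 ->
  gluing_sum H3 s (gunion H1 H2) (verts H1 `\ r) K ->
  add_edges K
    (fun e =>
       joins_sets G (verts H2 `\ r) a ((verts H1 `\ r) `|` (verts H3 `\ s)) e \/
       joins_sets G [fset r] a (verts H3 `\ s) e) G ->
  triplex a G r.
Proof.
move=> hH1 hH2 hH3 d12 d13 hc hglue [sKG eVG hadd].
have sUK := gluing_sum_subgraphr hglue.
have sH1G := subgraph_trans sKG (subgraph_trans sUK (gunion_subgraphl H1 H2)).
have sH2G := subgraph_trans sKG (subgraph_trans sUK (gunion_subgraphr hc)).
have notW2 x : x \in verts H2 -> x \notin verts H1 `\ r.
  move=> h2; rewrite !inE; apply/negP=> /andP[/negP hxr h1]; apply: hxr.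
  by rewrite -in_fset1 -d12 inE h2 h1.
have notW3 x : x \in verts H3 -> x \notin verts H1 `\ r.
  move=> h3; rewrite !inE; apply/negP=> /andP[_ h1].
  by have := in_fset0 x; rewrite -d13 inE h3 h1.
apply: (triplex_intro _ hH1 sH1G).
  apply/radialP; split.
    by case: hH1 => -[hr _] _ _; case: sH1G => /fsubsetP h _ _; apply: h.
  move=> v; rewrite eVG; have [_ _ _ -> _] := hglue; rewrite in_fsetU => /orP[hv|].
    exact: gluing_sum_radial hH1 hH3 (fsubset_refl _) hglue sKG v hv.
  rewrite /= in_fsetU => /orP[] hv.
    case: hH1 => /radialP[_ h] _ _; have [p hp] := h v hv; exists p.
    exact: subgraph_trail hp.
  case: hH2 => /radialP[_ h] _; have [p hp] := h v hv; exists p.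
  exact: subgraph_trail hp.
move=> [[u e] w]; rewrite /is_dart /dtail /dhead /dedge /= => /andP[he hj].
have hpos x y b : joins G e (x, a) (y, b) -> x \notin verts H1 `\ r ->
    u.1 \in verts H1 `\ r \/ u.2 = ~~ a ->
    w.1 \notin verts H1 `\ r /\ w.2 = a.
  move=> hj' hx hu; case: (joins_inj hj' hj) => -[eu ew]; rewrite eu ew /= in hu *.
    by case: hu => [h|]; [rewrite h in hx | case: (a)].
  by [].
have hneg (H : bigraph V E) : (forall x, x \in verts H -> x \notin verts H1 `\ r) ->
    (forall x y, ~ joins H e (x, ~~ a) (y, ~~ a)) -> e \in edges H -> joins H e u w ->
    u.1 \in verts H1 `\ r \/ u.2 = ~~ a ->
    w.1 \notin verts H1 `\ r /\ w.2 = a.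
  move=> hV hE heH hjH hu; have [/hV hu1 /hV hw1] := joins_verts heH hjH.
  split=> //; case: hu => [h|hua]; first by rewrite h in hu1.
  have [//|hwa] := eqVneq w.2 a; case: (hE u.1 w.1); rewrite -{1}hua.
  have -> : ~~ a = w.2 by move: hwa; case: (w.2) (a) => [] [].
  by rewrite -!surjective_pairing.
have [heK|heK] := boolP (e \in edges K); last first.
  have /hadd[] : e \in edges G `\` edges K by rewrite !inE he heK.
    case=> x [y [b [hx _ hj']]] _; apply: (hpos _ _ _ hj').
    by apply: notW2; move: hx; rewrite !inE => /andP[].
  case=> x [y [b [hx _ hj']]] _; apply: (hpos _ _ _ hj').
  by move: hx; rewrite !inE => /eqP->; rewrite eqxx.
have hjK : joins K e u w.
  by rewrite -(same_endsP _ _ (_ : same_ends G K e)) //; case: sKG => _ _; apply.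
case: (hglue) => _ _ _ _ [f [_ _ eE [hk _] hg]].
move: (heK); rewrite eE !in_fsetU => /orP[/orP[hek|/orP[he1|he2]]|].
- move=> _; have h3 : joins H3 e u w by rewrite -(same_endsP _ _ (hk _ hek)).
  have he3 : e \in edges H3 by move: hek; rewrite !inE => /andP[].
  apply: (hneg H3) => // x y.
  exact: linear_semiradial_edges hH3 he3.
- have sE : same_ends G H1 e by case: sH1G => _ _; apply.
  by rewrite he1 -(same_endsP _ _ sE) hj.
- move=> _; have sE : same_ends G H2 e by case: sH2G => _ _; apply.
  apply: (hneg H2) => //; last by rewrite -(same_endsP _ _ sE).
  by move=> x y; apply: sublinear_radial_edges hH2 he2.
case/imfsetP=> e0 he0 ef _.
have /andP[he3 hinc] : (e0 \in edges H3) && incident H3 s e0 by move: (he0); rewrite !inE.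
have [b [x [c hj0]]] : exists b x c, joins H3 e0 (s, b) (x, c).
  case/orP: hinc => /eqP <-.
    exists (ends H3 e0).1.2, (ends H3 e0).2.1, (ends H3 e0).2.2.
    by rewrite -!surjective_pairing joins_ends.
  exists (ends H3 e0).2.2, (ends H3 e0).1.1, (ends H3 e0).1.2.
  by rewrite -!surjective_pairing joinsC joins_ends.
(* Linearity excludes a loop at [s], so the end of [e0] away from [s] survives gluing, with the sign
   [a]. *)
have [hxs ec] := linear_semiradial_root_edges hH3 he3 hj0.
have [t htW] := (hg _ he0).1 _ _ _ (elimN eqP hxs) hj0.
rewrite -ef joinsC ec => htK; apply: (hpos x t b).
  by rewrite (same_endsP _ _ (_ : same_ends G K e)) //; case: sKG => _ _; apply.
by apply: notW3; case: (joins_verts he3 hj0).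
Qed.

(** * Contractions and spanning subgraphs *)

Lemma induced_edge G W e u w : joins G e u w ->
  (e \in edges (induced G W)) = [&& e \in edges G, u.1 \in W & w.1 \in W].
Proof. by move=> /joinsP hj; rewrite !inE; case: hj => -> //=; rewrite [(w.1 \in W) && _]andbC. Qed.

(** Testing [X] alone is enough: on the edges kept in [contracted], an end outside [X] lies in
    [T]. *)
Definition contract s (X : {fset V}) u : V * bool := if u.1 \in X then u else (s, u.2).

Lemma contract_ends_verts G s (X T : {fset V}) e :
  e \in [fset e in edges G | [&& (ends G e).1.1 \in X `|` T, (ends G e).2.1 \in X `|` T
    & ((ends G e).1.1 \in X) || ((ends G e).2.1 \in X)]] ->
  ((contract s X (ends G e).1).1 \in s |` X) && ((contract s X (ends G e).2).1 \in s |` X).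
Proof.
by rewrite /contract => _; case: ifP => h1; case: ifP => h2; rewrite !inE /= ?h1 ?h2 ?eqxx ?orbT.
Qed.

(* Identifies [T] with the new vertex [s], dropping the edges inside [T]. *)
Definition contracted G s X T : bigraph V E :=
  @Bigraph V E _ _ (fun e => (contract s X (ends G e).1, contract s X (ends G e).2))
    (@contract_ends_verts G s X T).

Lemma contracted_joins G s X T e u w :
  joins G e u w -> joins (contracted G s X T) e (contract s X u) (contract s X w).
Proof. by rewrite {2}/joins /= => /joinsP[] ->; rewrite eqxx ?orbT. Qed.

Lemma contracted_joinsP G s X T e u w : joins (contracted G s X T) e u w ->
  exists u' w', [/\ joins G e u' w', u = contract s X u' & w = contract s X w'].
Proof.
rewrite {1}/joins /= => /orP[] /eqP[<- <-].
  by exists (ends G e).1, (ends G e).2; split=> //; apply: joins_ends.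
by exists (ends G e).2, (ends G e).1; split=> //; rewrite joinsC joins_ends.
Qed.

Lemma contracted_edge G s X T e u w : joins G e u w ->
  (e \in edges (contracted G s X T)) =
  [&& e \in edges G, u.1 \in X `|` T, w.1 \in X `|` T & (u.1 \in X) || (w.1 \in X)].
Proof.
move=> /joinsP hj; rewrite !inE /=; case: hj => -> //=.
by do !case: (_ \in _).
Qed.

Lemma spanning_ends_verts G (D : {fset E}) e : e \in edges G `&` D ->
  ((ends G e).1.1 \in verts G) && ((ends G e).2.1 \in verts G).
Proof. by rewrite inE => /andP[/ends_verts]. Qed.

(** Serves to remove from [G] the edges that were added to the gluing sum. *)
Definition spanning G D : bigraph V E := Bigraph (@spanning_ends_verts G D).

(** * Decomposition of a triplex along its ground *)

Section Ground.

Variables (a : bool) (G H : bigraph V E) (r : V).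
Hypothesis radG : radial a G r.
Hypothesis subHG : subgraph H G.
Hypothesis strH : almost_strong a H r.
Hypothesis sublG : forall x, x \notin verts H `\ r -> sublinear a G r x.

Local Notation W := (verts H).

Let rW : r \in W. Proof. by case: strH => -[]. Qed.

Lemma notin_ground x : x \notin W -> x \notin W `\ r.
Proof. by move=> hx; rewrite !inE (negPf hx) andbF. Qed.

Lemma root_notin_ground : r \notin W `\ r.
Proof. by rewrite !inE eqxx. Qed.

(** Only departures have to avoid [W], since the last vertex [r] belongs to [W]. *)
Definition reaches x : Prop :=
  exists2 p, trail G (x, a) p (r, ~~ a) & forall d, d \in p -> (dtail d).1 \notin W.

(* The vertices of [H2] other than [r]; those of [H3] other than [s] are [far]. *)
Definition near : {fset V} := [fset x in verts G `\` W | `[< reaches x >]].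
Definition far : {fset V} := (verts G `\` W) `\` near.

Lemma nearP x : reflect (x \notin W /\ reaches x) (x \in near).
Proof.
rewrite !inE /=; apply: (iffP andP) => [[/andP[h _] /asboolP]|[h hx]] //.
by split; [rewrite h; case: hx => p /trail_verts | apply/asboolP].
Qed.

Lemma farP x : reflect [/\ x \in verts G, x \notin W & ~ reaches x] (x \in far).
Proof.
rewrite inE; apply: (iffP andP) => [[/nearP h]|[h1 h2 h3]].
  by rewrite inE => /andP[hW hG]; split=> // hx; apply: h.
by split; [apply/nearP => -[] | rewrite inE h2 h1].
Qed.

Lemma reaches_root : reaches r.
Proof. by exists [::] => //=; case: radG => ->; rewrite eqxx. Qed.

Lemma trail_sign u p : trail G u p (r, ~~ a) -> u.1 \notin W `\ r -> u.2 = a.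
Proof.
case: u => x b /= ht /sublG hx; have [//|hb] := eqVneq b a; case: hx.
have eb : b = ~~ a by move: hb; case: (a) (b) => [] [].
by apply/strongP; exists p; rewrite eb in ht.
Qed.

(** [H] has a ditrail from [y] to [r] departing by [~~ c], as [y] is strong in [H]. Prepending [e],
    which is not in [H] because [x] is not, gives a ditrail from [x], and [trail_sign] applies. *)
Lemma ground_edge_sign e x b y c : e \in edges G -> joins G e (x, b) (y, c) ->
  x \notin W -> y \in W `\ r -> b = a.
Proof.
move=> he hj hx; rewrite !inE => /andP[/eqP hyr hy].
have [p hp] : exists p, trail H (y, ~~ c) p (r, ~~ a).
  case: strH => hrad hstr _; have [->|hc] := eqVneq (~~ c) a.
    by case/radialP: hrad => _; apply.
  have -> : ~~ c = ~~ a by move: hc; case: (c) (a) => [] [].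
  exact/strongP/hstr.
apply: (@trail_sign (x, b) (((x, b), e, (y, c)) :: p)); last exact: notin_ground.
have heH : e \notin map (@dedge V E) p.
  apply: contra hx => /(trail_edges hp) heH.
  move: hj; rewrite (same_endsP _ _ (_ : same_ends G H e)).
    by case/(joins_verts heH).
  by case: subHG => _ _; apply.
by rewrite /= eqxx /is_dart he hj heH (subgraph_trail subHG hp).
Qed.

(** By [negative_edge_trail] such an edge would give a ditrail to [r] departing from [x] or [y] by
    [~~ a]. *)
Lemma outer_edge_sign e x y : e \in edges G -> x \notin W `\ r -> y \notin W `\ r ->
  ~ joins G e (x, ~~ a) (y, ~~ a).
Proof.
move=> he hx hy hj; have [_ /= hyG] := joins_verts he hj.
case/radialP: radG => _ /(_ y hyG)[p hp].
have [u [q [hq _ hu hxy]]] := negative_edge_trail he hj hp.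
have : u.2 = a; last by rewrite hu; case: (a).
by apply: trail_sign hq _; move: hxy; rewrite !inE => /orP[] /eqP->; rewrite -in_fsetD1.
Qed.

Lemma reaches_step e x y : e \in edges G -> joins G e (x, a) (y, ~~ a) ->
  x \notin W -> y \notin W `\ r -> reaches y -> reaches x.
Proof.
move=> he hj hx hy [p hp hpW].
have [/mapP[d hd ed]|hep] := boolP (e \in map (@dedge V E) p).
  (* If [p] already uses [e], it does so from [x], and its suffix is the witness; departing from [y]
     by [~~ a] contradicts [trail_sign]. *)
  have [q hq sq] := trail_suffix hp hd.
  have /andP[_] := trail_dart hp hd; rewrite -ed => hj'.
  case: (joins_inj hj hj') => -[etl _]; rewrite etl in hq.
    by exists (d :: q) => // d' /sq /hpW.
  by have := trail_sign hq hy; case: (a).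
exists (((x, a), e, (y, ~~ a)) :: p) => [|d].
  by rewrite /= eqxx /is_dart he hj hep /flip /= negbK.
by rewrite inE => /predU1P[->|/hpW].
Qed.

(** If [u] had the sign [~~ a], the other end would have the sign [a] by [outer_edge_sign], and then
    [reaches_step] would make that [far] vertex reach [r]. *)
Lemma reaches_edge_sign e u w : e \in edges G -> joins G e u w ->
  u.1 \in r |` near -> w.1 \in far -> u.2 = a.
Proof.
case: u w => [x b] [y c] he hj /= hx /farP[_ hyW hyr].
have [//|hb] := eqVneq b a; case: hyr.
have {hb} eb : b = ~~ a by move: hb; case: (a) (b) => [] [].
have [hxr hxW] : reaches x /\ x \notin W `\ r.
  move: hx; rewrite in_fset1U => /predU1P[->|/nearP[hxW]].
    by split; [exact: reaches_root | exact: root_notin_ground].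
  by split=> //; apply: notin_ground.
rewrite eb in hj; have ec : c = a.
  have [//|hc] := eqVneq c a; case: (outer_edge_sign he hxW (notin_ground hyW)).
  have ec : c = ~~ a by move: hc; case: (a) (c) => [] [].
  by rewrite ec in hj.
by rewrite ec in hj; apply: reaches_step he _ hyW hxW hxr; rewrite joinsC.
Qed.

Lemma trail_start_near u p : trail G u p (r, ~~ a) ->
  (forall d, d \in p -> (dtail d).1 \notin W) -> u.1 \in r |` near.
Proof.
move=> ht hW; rewrite in_fset1U; case: p ht hW => [|d p] ht hW.
  by case/andP: ht => _ /eqP[->]; rewrite eqxx.
have hu : u.1 \notin W by have := hW d (mem_head _ _); case/and4P: ht => /eqP->.
apply/orP; right; apply/nearP; split=> //; exists (d :: p) => //.
by rewrite -[a in (_, a)](trail_sign ht (notin_ground hu)) -surjective_pairing.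
Qed.

(** Every suffix is again a ditrail departing only outside [W], so all vertices on the way are [r]
    or [near]. *)
Lemma near_trail u p : trail G u p (r, ~~ a) ->
  (forall d, d \in p -> (dtail d).1 \notin W) ->
  trail (induced G (r |` near)) u p (r, ~~ a).
Proof.
elim: p u => [|d p IHp] u ht hW; have hu := trail_start_near ht hW.
  by move: ht => /= /andP[hG ->]; rewrite in_fsetI hG hu.
have hpW d' : d' \in p -> (dtail d').1 \notin W.
  by move=> hd'; apply: hW; rewrite inE hd' orbT.
case/and4P: ht => hd /andP[he hj] hn ht; have hh := trail_start_near ht hpW.
rewrite /= hd hn /is_dart (induced_edge _ hj) he hh (eqP hd) hu /=.
by rewrite IHp // andbT -(eqP hd).
Qed.

Lemma near_sublinear_radial : sublinear_radial a (induced G (r |` near)) r.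
Proof.
split.
  apply/radialP; split=> [|v]; first by rewrite !inE eqxx andbT; case: radG.
  rewrite in_fsetI in_fset1U => /andP[_ /predU1P[->|/nearP[_ [p hp hpW]]]].
    by exists [::]; rewrite /= !inE !eqxx !andbT; case: radG.
  by exists p; apply: near_trail.
(* No edge here has [~~ a] at both ends, so departures by [~~ a] persist and [r] is never reached by
   [~~ a]. *)
move=> x _ /strongP[p hp]; have p0 : p = [::].
  apply: (@no_negative_trail _ a (pred1 (r, ~~ a)) _ _ _ _ hp) => //=.
  move=> d /andP[he hj] hd; have hjG : joins G (dedge d) (dtail d) (dhead d) by [].
  move: he; rewrite (induced_edge _ hjG) => /and3P[he htl hhd].
  have hW y : y \in r |` near -> y \notin W `\ r.
    rewrite in_fset1U => /predU1P[->|/nearP[hy _]]; first exact: root_notin_ground.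
    exact: notin_ground.
  have hha : (dhead d).2 = a.
    have [//|hha] := eqVneq (dhead d).2 a.
    case: (outer_edge_sign he (hW _ htl) (hW _ hhd)); rewrite -{1}hd.
    have -> : ~~ a = (dhead d).2 by move: hha; case: (a) (dhead d).2 => [] [].
    by rewrite -!surjective_pairing.
  split=> //; apply/eqP => eh; move: hha; rewrite eh.
  by case: (a).
by move: hp; rewrite p0 /= => /andP[_ /eqP[_]]; case: (a).
Qed.

Lemma far_trail s u p : s \notin verts G -> trail G u p (r, ~~ a) -> u.1 \in far ->
  exists q b, [/\ trail (contracted G s far (W `\ r)) u q (s, b),
    {subset map (@dedge V E) q <= map (@dedge V E) p} & exists t, t \in W `\ r].
Proof.
move=> hs; elim: p u => [|d p IHp] u hp hu.
  case/andP: hp => _ /eqP[er _]; case/farP: hu => _ /negP[].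
  by rewrite -er.
have [_ huW hur] := farP _ hu.
have hua := trail_sign hp (notin_ground huW).
case/and4P: hp => /eqP hd /andP[he hj] hn hp; rewrite hd in hj.
have hc := contracted_joins s far (W `\ r) hj; rewrite {1}/contract hu in hc.
have [hyT|hyT] := boolP ((dhead d).1 \in W `\ r).
  exists [:: (u, dedge d, (s, (dhead d).2))], (dhead d).2; split; last by exists (dhead d).1.
    rewrite /= eqxx flipK eqxx !inE /= eqxx !andbT /is_dart.
    rewrite (contracted_edge s _ _ hj) he !in_fsetU hu hyT orbT /=.
    move: hc; rewrite /contract; case: ifP => // /farP[_ /negP[]].
    by move: hyT; rewrite !inE => /andP[].
  by move=> e; rewrite !inE => ->.
have hhs : (dhead d).2 = ~~ a by rewrite -(trail_sign hp hyT) negbK.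
have hstep : ~ reaches (dhead d).1.
  move=> hreach; apply: hur; apply: reaches_step he _ huW hyT hreach.
  by rewrite -{1}hua -hhs -!surjective_pairing.
have hyfar : (dhead d).1 \in far.
  apply/farP; split=> //; first by case: (joins_verts he hj).
  apply/negP=> hyW; move: hyT; rewrite !inE hyW andbT negbK => /eqP hyr.
  by apply: hstep; rewrite hyr; apply: reaches_root.
have [q [b [hq sq ht]]] := IHp _ hp hyfar.
exists (d :: q), b; split=> // [|e]; last first.
  by rewrite !inE => /predU1P[->|/sq ->]; rewrite ?eqxx ?orbT.
rewrite /= hd eqxx hq andbT /=; apply/andP; split; last first.
  by apply: contra hn => /sq.
rewrite /is_dart (contracted_edge s _ _ hj) he !in_fsetU hu hyfar hd /=.
by move: hc; rewrite /contract hyfar.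
Qed.

Lemma far_linear_semiradial s : s \notin verts G ->
  linear_semiradial a (contracted G s far (W `\ r)) s.
Proof.
move=> hs; set H3 := contracted _ _ _ _.
have hsf : s \notin far by apply: contra hs => /farP[].
have nsf x : x \in far -> x != s by move=> hx; apply: contraNneq hsf => <-.
split.
- split=> [|v]; first by rewrite !inE eqxx.
  rewrite in_fset1U => /predU1P[->|hv].
    by exists (~~ a); apply/ab_ditrailP; exists [::]; rewrite /= !inE !eqxx.
  have [hvG _ _] := farP _ hv; case/radialP: radG => _ /(_ v hvG)[p hp].
  have [q [b [hq _ _]]] := far_trail hs hp hv.
  by exists b; apply/ab_ditrailP; exists q.
- move=> e; rewrite (contracted_edge _ _ _ (joins_ends G e)) => /and4P[_ _ _].
  rewrite /loop_over /= /contract => /orP[] he; rewrite he ?(negPf (nsf _ he)) ?andbF //.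
- move=> x p b hp hb.
  have ht : trail H3 (x, ~~ a) p (s, b) by rewrite -trailE hp hb.
  (* With arrivals at [s] as [Q]: every edge left by [~~ a] leads into [far] and arrives there by
     [a]. *)
  apply: (@no_negative_trail _ a [pred v | v.1 == s] _ _ _ _ ht) => //=.
  move=> [[u e] w]; rewrite /is_dart /dtail /dhead /dedge /= => /andP[he hj] hu.
  have [u' [w' [hjG eu ew]]] := contracted_joinsP hj.
  have {}he : e \in edges H3 := he.
  move: he; rewrite (contracted_edge _ _ _ hjG) => /and4P[he hu' hw' huw].
  have hu2 : u'.2 = ~~ a by rewrite -hu eu /contract; case: ifP.
  have hout x' : x' \in far -> x' \notin W by move=> /farP[].
  have nT x' : x' \in far -> x' \notin W `\ r by move=> /hout/notin_ground.
  have hpos x' (y' : V * bool) : x' \in far -> joins G e (x', ~~ a) y' -> y'.1 \notin W `\ r.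
    move=> hx hj'; apply/negP => hy.
    have := ground_edge_sign he (_ : joins G e (x', ~~ a) (y'.1, y'.2)) (hout _ hx) hy.
    by rewrite -surjective_pairing => /(_ hj'); case: (a).
  have hjx : joins G e (u'.1, ~~ a) w' by rewrite -hu2 -surjective_pairing.
  have hwf : w'.1 \in far.
    have [huf|huf] := boolP (u'.1 \in far); last by rewrite (negPf huf) in huw.
    by move: hw'; rewrite in_fsetU => /orP[] // hw; case/negP: (hpos _ _ huf hjx).
  rewrite ew /contract hwf; split; last by rewrite (negPf (nsf _ hwf)).
  have [//|hwa] := eqVneq w'.2 a.
  have ewa : w'.2 = ~~ a by move: hwa; case: (a) w'.2 => [] [].
  have hjx' : joins G e (u'.1, ~~ a) (w'.1, ~~ a).
    by move: hjx; rewrite [w' in joins _ _ _ w']surjective_pairing ewa.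
  move: hu'; rewrite in_fsetU => /orP[] hu'.
    by case: (outer_edge_sign he (nT _ hu') (nT _ hwf) hjx').
  by move: hjx'; rewrite joinsC => /(hpos _ _ hwf)/negP; case.
Qed.

Lemma ground_cases x : x \in verts G -> [|| x \in W, x \in near | x \in far].
Proof. by rewrite !inE => ->; case: (x \in W) (`[< _ >]) => [] []. Qed.

Lemma ground_decomposition s : s \notin verts G ->
  let H1 := induced G W in
  let H2 := induced G (r |` near) in
  let H3 := contracted G s far (W `\ r) in
  let K := spanning G (edges H3 `|` edges (gunion H1 H2)) in
  [/\ verts H1 = W, verts H2 = r |` near,
    gluing_sum H3 s (gunion H1 H2) (W `\ r) K &
    add_edges K
      (fun e =>
         joins_sets G near a ((W `\ r) `|` far) e \/ joins_sets G [fset r] a far e) G].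
Proof.
move=> hs H1 H2 H3 K.
have hsf : s \notin far by apply: contra hs => /farP[].
have sV : W `<=` verts G by case: subHG.
have eV1 : verts H1 = W by apply/fsetIidPr.
have eV2 : verts H2 = r |` near.
  apply/fsetIidPr/fsubsetP=> x; rewrite in_fset1U => /predU1P[->|].
    by case: radG.
  by case/nearP=> _ [p /trail_verts].
have sE : edges H3 `|` edges (gunion H1 H2) `<=` edges G.
  by apply/fsubsetP=> e; rewrite !inE /= => /orP[/andP[]|/orP[]/andP[]].
have eE : edges K = edges H3 `|` edges (gunion H1 H2) by apply/fsetIidPr.
split=> //; last first.
- split=> // [|e]; first by split=> //; [exact: fsubsetIl | move=> e _; apply: joins_ends].
  rewrite in_fsetD eE !in_fsetU !negb_or => /andP[/and3P[h3 h1 h2] he].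
  have hNF u w : joins G e u w -> u.1 \in r |` near -> w.1 \in far ->
      joins_sets G near a ((W `\ r) `|` far) e \/ joins_sets G [fset r] a far e.
    move=> hj hu hw; have hua := reaches_edge_sign he hj hu hw.
    have hj' : joins G e (u.1, a) (w.1, w.2) by rewrite -{1}hua -!surjective_pairing.
    move: hu; rewrite in_fset1U => /orP[hu|hu]; [right|left];
      by exists u.1, w.1, w.2; split=> //; rewrite ?in_fset1 // in_fsetU hw orbT.
  have hNT u w : joins G e u w -> u.1 \in r |` near -> w.1 \in W `\ r ->
      joins_sets G near a ((W `\ r) `|` far) e \/ joins_sets G [fset r] a far e.
    move=> hj; have hwW : w.1 \in W `\ r -> w.1 \in W by rewrite in_fsetD1 => /andP[].
    rewrite in_fset1U => /predU1P[hu /hwW hw|hu hw].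
      by move: h1; rewrite (induced_edge _ hj) he hu rW hw.
    left; exists u.1, w.1, w.2; split=> //; first by rewrite in_fsetU hw.
    have [hunW _] := nearP _ hu.
    have hj' : joins G e (u.1, u.2) (w.1, w.2) by rewrite -!surjective_pairing.
    by rewrite -{1}(ground_edge_sign he hj' hunW hw).
  have cls x : x \in verts G -> [|| x \in W `\ r, x \in r |` near | x \in far].
    move/ground_cases; rewrite in_fsetD1 in_fset1U.
    by case: (x == r) (x \in W) => [] [].
  have := joins_ends G e; move: (ends G e).1 (ends G e).2 => u w hj.
  have [/cls hu /cls hw] := joins_verts he hj.
  move: h1 h2 h3 hu hw; rewrite !(induced_edge _ hj) (contracted_edge _ _ _ hj) he /=.
  have hTW x : x \in W `\ r -> x \in W by rewrite in_fsetD1 => /andP[].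
  move=> h1 h2 h3 /or3P[] hu /or3P[] hw.
  + by rewrite !hTW in h1.
  + by apply: (hNT w u) => //; rewrite joinsC.
  + by rewrite !in_fsetU hu hw !orbT in h3.
  + exact: hNT hj hu hw.
  + by rewrite hu hw in h2.
  + exact: hNF hj hu hw.
  + by rewrite !in_fsetU hu hw !orbT in h3.
  + by apply: (hNF w u) => //; rewrite joinsC.
  + by rewrite !in_fsetU hu hw in h3.
have eV12 : verts (gunion H1 H2) = W `|` (r |` near) by congr (_ `|` _).
have disE : [disjoint edges H3 & edges (gunion H1 H2)].
  apply/fdisjointP=> e; have hj := joins_ends G e.
  rewrite in_fsetU !(induced_edge _ hj) (contracted_edge _ _ _ hj).
  case/and4P=> -> _ _ hfar; rewrite /= negb_or.
  have hf y : y \in far -> (y \notin W) /\ (y \notin r |` near).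
    case/farP=> _ hyW hyr; split=> //; rewrite in_fset1U; apply/negP=> /predU1P[ey|/nearP[]//].
    by apply: hyr; rewrite ey; apply: reaches_root.
  by case/orP: hfar => /hf[/negPf-> /negPf->]; rewrite ?andbF.
have contr_s u b : (s, b) = contract s far u -> u.1 \notin far /\ u.2 = b.
  rewrite /contract; case: ifP => [hu eu|_ [->]] //.
  by move: hsf; rewrite [s](congr1 fst eu) hu.
have contr_far u : (contract s far u).1 != s -> contract s far u = u.
  by rewrite /contract; case: ifP => //; rewrite eqxx.
split.
- split=> //; apply/fdisjointP=> x.
  rewrite eV12 in_fset1U in_fsetU in_fset1U => /predU1P[->|/farP[_ hxW hxr]].
    apply/negP=> /or3P[/(fsubsetP sV)|/eqP es|/nearP[_ [p /trail_verts]]].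
    + by rewrite (negPf hs).
    + by move: hs; rewrite es; case: radG => ->.
    + by rewrite (negPf hs).
  rewrite (negPf hxW) /=; apply/negP=> /predU1P[exr|/nearP[_]//].
  by apply: hxr; rewrite exr; apply: reaches_root.
- by rewrite in_fset1U eqxx.
- by rewrite eV12; apply: fsubset_trans (fsubsetUl _ _); apply: fsubD1set.
- apply/fsetP=> x; rewrite eV12 2!in_fsetU in_fsetD1 !in_fset1U.
  change (verts K) with (verts G).
  apply/idP/idP=> [hx|].
    have -> : x != s by apply: contraNneq hs => <-.
    by case/or3P: (ground_cases hx) => ->; rewrite ?orbT.
  case/orP=> [/andP[/negPf->] /farP[]//|/or3P[/(fsubsetP sV)//|/eqP->|]].
    by case: radG.
  by case/nearP=> _ [p /trail_verts].
exists id; split=> //.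
- move=> e; rewrite in_fset inE => /andP[he hi].
  by rewrite negb_or (fdisjointP disE _ he) andbT in_fset inE hi andbF.
- rewrite eE imfset_id; move: (edges H3) (edges (gunion H1 H2)) => A B.
  apply/fsetP=> e; rewrite !in_fsetU !in_fset !inE.
  by case: (incident H3 s e); case: (e \in A); rewrite ?orbT ?orbF.
- split=> e.
    rewrite in_fset inE /incident negb_or => /and3P[_ /contr_far h1 /contr_far h2].
    by rewrite /same_ends /= h1 h2; apply: joins_ends.
  move=> _; rewrite /same_ends /joins /= /union_ends.
  by case: ifP; rewrite -surjective_pairing eqxx.
- move=> e; rewrite in_fset inE => /andP[he _]; split=> [v b c hvs|b c] hj.
    have [u [w [hjG eu ew]]] := contracted_joinsP hj.
    have [hu eb] := contr_s _ _ eu.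
    have {}ew : w = (v, c) by rewrite ew contr_far // -ew; apply/eqP.
    move: he; rewrite (contracted_edge _ _ _ hjG) in_fsetU (negPf hu) => /and4P[_ hT _ _].
    by exists u.1 => //; rewrite -ew -eb -surjective_pairing.
  have [u [w [hjG /contr_s[hu _] /contr_s[hw _]]]] := contracted_joinsP hj.
  by move: he; rewrite (contracted_edge _ _ _ hjG) (negPf hu) (negPf hw) !andbF.
Qed.

Lemma far_eq0 : W = [fset r] -> (exists s, s \notin verts G) -> far = fset0.
Proof.
move=> eW [s hs]; apply/fsetP=> v; rewrite in_fset0; apply/negP=> hv.
have [hvG _ _] := farP _ hv; case/radialP: radG => _ /(_ v hvG)[p hp].
have [q [b [_ _ [t]]]] := far_trail hs hp hv.
by rewrite eW fsetDv in_fset0.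
Qed.

End Ground.

End Trails.

Theorem theorem11p5 (V E : choiceType)
    (fresh : forall A : {fset V}, exists x, x \notin A)
    (a : bool) (G : bigraph V E) (r : V) (hr : r \in verts G) :
  triplex a G r <->
  exists (H1 H2 H3 : bigraph V E) (s : V),
    [/\ almost_strong a H1 r, sublinear_radial a H2 r
      & linear_semiradial a H3 s] /\
    [/\ verts H2 `&` verts H1 = [fset r],
        verts H3 `&` verts H1 = fset0,
        verts H3 `&` verts H2 = fset0
      & verts H1 = [fset r] -> verts H3 = [fset s]] /\
    compatible H1 H2 /\
    exists K : bigraph V E,
      gluing_sum H3 s (gunion H1 H2) (verts H1 `\ r) K /\
      add_edges K
        (fun e =>
           joins_sets G (verts H2 `\ r) a
             ((verts H1 `\ r) `|` (verts H3 `\ s)) e \/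
           joins_sets G [fset r] a (verts H3 `\ s) e)
        G.
Proof.
split=> [/triplexP[hrad hrs [H [sHG hH hout]]]|[H1 [H2 [H3 [s]]]]]; last first.
  case=> -[hH1 hH2 hH3] [[d12 d13 _ _] [hc [K [hglue hadd]]]].
  exact: gluing_sum_triplex hH1 hH2 hH3 d12 d13 hc hglue hadd.
(* A strong vertex starts a ditrail and so belongs to [G]; this extends [hout] to names outside
   [G]. *)
have subl x : x \notin verts H `\ r -> sublinear a G r x.
  rewrite in_fsetD1 negb_and negbK => /predU1P[->//|hx] hstr.
  case/strongP: (hstr) => p /trail_verts hxG.
  by apply: hout hstr; rewrite in_fsetD hx.
have [s hs] := fresh (verts G).
have [eV1 eV2 hglue hadd] := ground_decomposition hrad sHG hH subl hs.
set X := far a G H r in hglue hadd *; set N := near a G H r in eV2 hglue hadd *.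
have rW : r \in verts H by case: hH => -[].
exists (induced G (verts H)), (induced G (r |` N)), (contracted G s X (verts H `\ r)), s.
have rX x : x \in X -> x \notin r |` N.
  case/farP=> _ hxW hx; rewrite in_fset1U; apply/negP=> /predU1P[exr|/nearP[]//].
  by rewrite exr rW in hxW.
split; first split.
- exact: almost_strong_induced.
- exact: near_sublinear_radial.
- exact: far_linear_semiradial.
have eV3 : verts (contracted G s X (verts H `\ r)) = s |` X by [].
rewrite eV1 eV2 eV3; split; [split|split].
- apply/fsetP=> x; rewrite in_fsetI in_fset1U in_fset1.
  have [->|_] := eqVneq x r; first by rewrite rW.
  by apply/negP=> /andP[/nearP[/negPf->]].
- apply/fsetP=> x; rewrite in_fsetI in_fset1U in_fset0; apply/negP=> /andP[hx hxW].
  move: hx => /predU1P[exs|/farP[_ /negP//]].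
  by case/negP: hs; rewrite -exs; case: sHG => /fsubsetP sV _ _; apply: sV.
- apply/fsetP=> x; rewrite in_fsetI in_fset1U in_fset0; apply/negP=> /andP[].
  case/predU1P=> [->|/rX/negP//]; rewrite in_fset1U => /predU1P[esr|].
    by case/negP: hs; rewrite esr.
  by case/nearP=> _ [p /trail_verts] hsG; case/negP: hs.
- move=> eW; have -> : X = fset0 := far_eq0 hrad hH subl eW (ex_intro _ s hs).
  exact: fsetU0.
- by move=> e _ _; apply: joins_ends.
exists (spanning G (edges (contracted G s X (verts H `\ r)) `|`
  edges (gunion (induced G (verts H)) (induced G (r |` N))))); split=> //.
(* Removing the roots from the vertex sets of [H2] and [H3] gives back [N] and [X], as [hadd] has
   them. *)
have rN : r \notin N by apply/nearP; rewrite rW => -[].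
have hsX : s \notin X by apply: contra hs => /farP[].
by rewrite !fsetU1K.
Qed.
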